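(* If $G$ is a graph whose largest (connected) component has $k$ vertices, then $\chi_{pc}(G) \leq k$.
   Context: All graphs are finite and simple, with at least one vertex. Let $k$ be a positive integer. A $k$-assignment $L$ for a graph $G$ assigns to each vertex $v$ a set $L(v)$ of exactly $k$ colors; its palette is $\mathcal{L} = \bigcup_{v \in V(G)} L(v)$, and for $c \in \mathcal{L}$, $\eta(c) = |\{v \in V(G) : c \in L(v)\}|$. A proper $L$-coloring of $G$ is a proper coloring $f$ of $G$ with $f(v) \in L(v)$ for every vertex $v$. It is a proportional $L$-coloring if for every $c \in \mathcal{L}$, $|f^{-1}(c)|$ equals $\lfloor \eta(c)/k \rfloor$ or $\lceil \eta(c)/k \rceil$. $G$ is proportionally $k$-choosable if a proportional $L$-coloring of $G$ exists for every $k$-assignment $L$ for $G$. The proportional choice number $\chi_{pc}(G)$ is the smallest positive integer $k$ such that $G$ is proportionally $k$-choosable. *)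

(* Defs.v *)
From mathcomp Require Import all_boot.
From mathcomp Require Import finmap.

Set Implicit Arguments.
Unset Strict Implicit.
Unset Printing Implicit Defensive.

Record graph := Graph {
  vertex :> finType;
  edge : rel vertex;
  edge_sym : symmetric edge;
  edge_irr : irreflexive edge;
  vertex_gt0 : 0 < #|vertex|
}.

Arguments edge {g} u v.

Definition components (G : graph) : {set {set G}} :=
  equivalence_partition (connect (@edge G)) [set: G].

(* For 0 < d this is the ceiling of n / d: see leq_ceil_div below. *)
Definition ceil_div (n d : nat) : nat := n %/ d + ~~ (d %| n).

Lemma leq_ceil_div n d m : 0 < d -> (ceil_div n d <= m) = (n <= m * d).
Proof.
move=> d_gt0; rewrite /ceil_div.
have [/dvdnP[q ->]|ndvd] := boolP (d %| n).
  by rewrite mulnK // addn0 leq_pmul2r.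
rewrite addn1 ltn_divLR // [RHS]leq_eqVlt.
by case: eqP => // nE; rewrite nE dvdn_mull in ndvd.
Qed.

Section ListColoring.
Variables (G : graph) (C : choiceType).
Implicit Types (k : nat) (L : G -> {fset C}) (f : G -> C).

Definition is_assignment k L := forall v, #|` L v| = k.

Definition palette L : {fset C} := (\bigcup_(v <- enum G) L v)%fset.

Definition eta L (c : C) : nat := #|[set v : G | c \in L v]|.

Definition is_proper_coloring f := forall u v : G, edge u v -> f u <> f v.

Definition is_proper_list_coloring L f :=
  is_proper_coloring f /\ (forall v, f v \in L v).

Definition is_proportional_coloring k L f :=
  is_proper_list_coloring L f /\
  forall c, c \in palette L ->
    #|[set v : G | f v == c]| = eta L c %/ k \/
    #|[set v : G | f v == c]| = ceil_div (eta L c) k.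

End ListColoring.

(* Colors range over arbitrary types (with decidable equality and choice, so
   that finite sets of colors are available), not over a fixed universe. *)
Definition proportionally_choosable (G : graph) (k : nat) : Prop :=
  forall (C : choiceType) (L : G -> {fset C}),
    is_assignment k L -> exists f : G -> C, is_proportional_coloring k L f.

(* The proportional choice number as a functional relation: using it through
   "exists m, is_chi_pc G m /\ ..." also asserts that the minimum exists. *)
Definition is_chi_pc (G : graph) (m : nat) : Prop :=
  [/\ 0 < m, proportionally_choosable G m &
      forall j, 0 < j -> proportionally_choosable G j -> m <= j].

Lemma is_chi_pc_uniq (G : graph) m n : is_chi_pc G m -> is_chi_pc G n -> m = n.
Proof.
move=> [m0 Hm minm] [n0 Hn minn].
by apply/eqP; rewrite eqn_leq minm // minn.
Qed.

(* Main.v *)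
(** Giving every pair (v, c) with c in L(v) the weight 1/k is a fractional
    coloring that uses c exactly eta(c)/k times in all and at most once in each
    component, because components have at most k vertices; it remains to round
    this flow.  For each component t and color c take two nodes p and p' (for
    (t, c)), and cut the vertices having c in their list into blocks of k, the
    last one possibly incomplete.  Multiplied by k, the weights become a
    bipartite multigraph between the vertices and the nodes p' on one side and
    the nodes p and the blocks on the other: v is joined to p = (t, c) if v is
    in t and c is in L(v), p' is joined to each block of c once for every vertex
    of t in that block, and p to p' by enough edges to make both degrees k.  All
    degrees are k except that incomplete blocks have fewer, so some matching
    covers everything except possibly incomplete blocks.  Coloring v with c
    when v is matched to (t, c), c is used once in t exactly when p' is matched
    to a block of c, hence as often as there are matched blocks of c. *)

Require Import Defs.
From mathcomp Require Import all_boot.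
From mathcomp Require Import finmap.
From mathcomp Require boolp.

Set Implicit Arguments.
Unset Strict Implicit.
Unset Printing Implicit Defensive.

(** * Hall's marriage theorem *)

(** Induction on [#|D|]. If a nonempty proper subset [S] is tight, match [S] inside its
    neighbourhood and [D :\: S] outside it; otherwise such subsets have a spare neighbour, so any
    edge at [x0] can be removed. [f0] provides a total function when [D] is empty. *)
Lemma hall_on (X Y : finType) (f0 : X -> Y) (D : {set X}) (e : X -> {set Y}) :
    (forall S : {set X}, S \subset D -> #|S| <= #|\bigcup_(x in S) e x|) ->
  exists2 f : X -> Y, {in D &, injective f} & {in D, forall x, f x \in e x}.
Proof.
have [n] := ubnP #|D|; elim: n => // n IHn in D e *; rewrite ltnS => leDn hallD.
have [->|/set0Pn[x0 x0D]] := eqVneq D set0.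
  by exists f0 => [x y|x]; rewrite inE.
case: (boolP [exists S : {set X}, [&& S \proper D, S != set0
          & #|\bigcup_(x in S) e x| <= #|S|]]) => [|noS].
  case/existsP=> S /and3P[ltSD Sn0 tight].
  have sSD := proper_sub ltSD.
  have [|S' sS'S|f1 injf1 f1e] := IHn S e.
  - exact: leq_trans (proper_card ltSD) leDn.
  - by apply: hallD; apply: subset_trans sSD.
  set N := \bigcup_(x in S) e x in tight.
  have [||f2 injf2 f2e] := IHn (D :\: S) (fun x => e x :\: N).
  - apply: leq_trans leDn; apply/proper_card/properP; split; first exact: subsetDl.
    by have [x xS] := set0Pn _ Sn0; exists x; rewrite ?inE ?xS ?(subsetP sSD).
  - move=> S' sS'; have /subsetDP[sS'D disjS'S] := sS'.
    (* Hall's condition for [S' :|: S], minus the tightness of [S], is the condition for [S']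
       outside [N]. *)
    have := hallD (S' :|: S); rewrite subUset sS'D sSD => /(_ isT).
    rewrite bigcup_setU -/N cardsU (disjoint_setI0 disjS'S) cards0 subn0.
    have -> : \bigcup_(x in S') e x :|: N
              = (\bigcup_(x in S') (e x :\: N)) :|: N.
      apply/setP=> y; rewrite !inE; case: (boolP (y \in N)) => yN; rewrite ?orbT //.
      rewrite !orbF; apply/bigcupP/bigcupP => -[x xS' yx]; exists x => //.
        by rewrite inE yN.
      by case/setDP: yx.
    move=> /leq_trans/(_ (leq_card_setU _ _)) le1.
    by rewrite -(leq_add2r #|S|); apply: leq_trans le1 _; rewrite leq_add2l.
  have f1N x : x \in S -> f1 x \in N by move=> xS; apply/bigcupP; exists x; rewrite ?f1e.
  have f2N x : x \in D -> x \notin S -> f2 x \in e x :\: N.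
    by move=> xD xS; rewrite f2e // inE xS.
  exists (fun x => if x \in S then f1 x else f2 x) => [x y xD yD|x xD]; last first.
    by case: ifPn => xS; [exact: f1e | case/setDP: (f2N x xD xS)].
  case: ifPn => xS; case: ifPn => yS eqf.
  - exact: injf1.
  - by have := f2N y yD yS; rewrite -eqf inE f1N.
  - by have := f2N x xD xS; rewrite eqf inE f1N.
  - by apply: injf2; rewrite ?inE ?xS ?yS.
have slack (S : {set X}) :
    S \proper D -> S != set0 -> #|S| < #|\bigcup_(x in S) e x|.
  move=> ltSD Sn0; rewrite ltnNge; apply: contra noS => tight.
  by apply/existsP; exists S; apply/and3P.
have [y0 y0e] : exists y, y \in e x0.
  apply/set0Pn; rewrite -card_gt0.
  by have := hallD [set x0]; rewrite sub1set x0D big_set1 cards1 => /(_ isT).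
have [||f fI fe] := IHn (D :\ x0) (fun x => e x :\ y0).
- by apply: leq_trans leDn; rewrite (cardsD1 x0 D) x0D.
- move=> S sS; have [->|Sn0] := eqVneq S set0; first by rewrite cards0.
  have ltSD : S \proper D by apply: sub_proper_trans sS _; rewrite properD1.
  have -> : \bigcup_(x in S) (e x :\ y0) = (\bigcup_(x in S) e x) :\ y0.
    apply/setP=> y; apply/bigcupP/setD1P => [[x xS /setD1P[-> yx]]|[yy0 /bigcupP[x xS yx]]].
      by split=> //; apply/bigcupP; exists x.
    by exists x; rewrite // !inE yy0.
  have := slack S ltSD Sn0.
  by rewrite (cardsD1 y0 (\bigcup_(x in S) e x)); case: (y0 \in _) => //; apply: ltnW.
have f_neq x : x \in D -> x != x0 -> f x != y0 /\ f x \in e x.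
  by move=> xD xx0; apply/setD1P/fe; rewrite !inE xx0.
exists (fun x => if x == x0 then y0 else f x) => [x y xD yD|x xD]; last first.
  by have [->|xx0] := eqVneq x x0; [|case: (f_neq x)].
have [->|xx0] := eqVneq x x0; have [->|yx0] := eqVneq y x0 => // eqf.
- by have [] := f_neq y yD yx0; rewrite -eqf eqxx.
- by have [] := f_neq x xD xx0; rewrite eqf eqxx.
- by apply: fI; rewrite // !inE ?xx0 ?yx0.
Qed.

Lemma hall (X Y : finType) (e : X -> {set Y}) :
    (forall S : {set X}, #|S| <= #|\bigcup_(x in S) e x|) ->
  exists2 f : X -> Y, injective f & forall x, f x \in e x.
Proof.
move=> hallX.
have /fin_all_exists[f0 _] : forall x, exists y, y \in e x.
  move=> x; apply/set0Pn; rewrite -card_gt0.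
  by have := hallX [set x]; rewrite big_set1 cards1.
have [|f fI fe] := @hall_on X Y f0 setT e; first by move=> S _.
by exists f => [x y|x]; [apply: fI; rewrite inE | apply: fe; rewrite inE].
Qed.

(** * Matchings from weights *)

Lemma sum_delta (I : finType) (i : I) (F : I -> nat) :
  \sum_j (i == j) * F j = F i.
Proof.
rewrite (bigD1 i) //= eqxx mul1n big1 ?addn0 // => j.
by rewrite eq_sym => /negPf->.
Qed.

Lemma sum_pair (I J : finType) (F : I * J -> nat) :
  \sum_p F p = \sum_i \sum_j F (i, j).
Proof. by rewrite pair_bigA; apply: eq_bigr => -[]. Qed.

(** Double counting gives Hall's condition: the weight [k * #|S|] leaving [S] enters its
    neighbourhood, whose columns hold at most [k] each. *)
Lemma matching_of_weights (X Y : finType) (k : nat) (w : X -> Y -> nat) :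
    0 < k -> (forall x, \sum_y w x y = k) -> (forall y, \sum_x w x y <= k) ->
  exists2 f : X -> Y, injective f & forall x, 0 < w x (f x).
Proof.
move=> k0 rowk colk.
have [S|f fI fw] := @hall X Y (fun x => [set y | 0 < w x y]); last first.
  by exists f => // x; have := fw x; rewrite inE.
set N := \bigcup_(x in S) _.
rewrite -(leq_pmul2r k0) -!sum_nat_const.
have -> : \sum_(x in S) k = \sum_(x in S) \sum_(y in N) w x y.
  apply: eq_bigr => x xS; rewrite -(rowk x) (bigID (mem N)) /= [X in _ + X]big1 ?addn0 //.
  move=> y yN; apply/eqP; rewrite -leqn0 leqNgt; apply: contra yN => wxy.
  by apply/bigcupP; exists x; rewrite ?inE.
rewrite exchange_big /=; apply: leq_sum => y _; apply: leq_trans (colk y).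
by rewrite [X in _ <= X](bigID (mem S)) /= leq_addr.
Qed.

(* Apply the previous lemma to the k-regular weights [[w, 0], [d, w^T]] on
   X + Y, where d is the diagonal matrix of the column deficits of w. *)
Lemma matching_of_weights_saturating (X Y : finType) (k : nat)
    (w : X -> Y -> nat) :
    0 < k -> (forall x, \sum_y w x y = k) -> (forall y, \sum_x w x y <= k) ->
  exists f : X -> Y, [/\ injective f, forall x, 0 < w x (f x)
    & forall y, \sum_x w x y = k -> exists x, f x = y].
Proof.
move=> k0 rowk colk.
pose W (a b : X + Y) : nat := match a, b with
  | inl x, inr y => w x y
  | inl _, inl _ => 0
  | inr y, inl x => w x y
  | inr y, inr z => (y == z) * (k - \sum_x w x y)
  end.
have [||h hI hW] := @matching_of_weights _ _ k W k0.
- case=> [x|y]; rewrite big_sumType /=; first by rewrite big1_eq rowk.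
  by rewrite sum_delta subnKC.
- case=> [x|y]; rewrite big_sumType /=; first by rewrite big1_eq rowk.
  under [X in _ + X]eq_bigr => z _ do rewrite eq_sym.
  by rewrite sum_delta subnKC.
have /fin_all_exists[f hf] : forall x, exists y, h (inl x) = inr y.
  move=> x; have := hW (inl x) => /=.
  by case: (h (inl x)) => // y _; exists y.
exists f; split=> [x x' eqf|x|y fully].
- by have /hI[] : h (inl x) = h (inl x') by rewrite !hf eqf.
- by have := hW (inl x); rewrite hf.
(* An injection of [X + Y] into itself is onto, so [inr y] has a preimage; a full column has deficit
   0, so that preimage lies in [X]. *)
have [g _ gK] := injF_bij hI.
have := hW (g (inr y)); case E: (g (inr y)) => [x|z].
  by move=> _; exists x; have := gK (inr y); rewrite E hf => -[].
rewrite -E gK E /=; case: eqP => // ->.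
by rewrite fully subnn muln0.
Qed.

(** * Block sizes, floors and ceilings *)

Lemma count_divn_eq k j n : 0 < k -> j.+1 * k <= n ->
  count (fun i => i %/ k == j) (iota 0 n) = k.
Proof.
(* Cut the range at [j * k] and [j.+1 * k]: only the middle piece counts, and it counts entirely. *)
move=> k0 le_n; rewrite -(subnKC le_n) mulSnr !iotaD !count_cat add0n.
rewrite (_ : count _ (iota 0 _) = 0) ?add0n; last first.
  apply/eqP; rewrite eqn0Ngt -has_count; apply/hasPn=> i; rewrite mem_iota add0n => /= lti.
  by rewrite neq_ltn ltn_divLR // lti.
rewrite (_ : count _ (iota (_ + _) _) = 0) ?addn0; last first.
  apply/eqP; rewrite eqn0Ngt -has_count; apply/hasPn=> i; rewrite mem_iota => /andP[lei _].
  by rewrite neq_ltn leq_divRL // mulSnr lei orbT.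
rewrite -[RHS](size_iota (j * k)); apply/eqP; rewrite -all_count; apply/allP=> i.
rewrite mem_iota => /andP[lei lti].
by rewrite /= eqn_leq -ltnS ltn_divLR // leq_divRL // lei mulSnr lti.
Qed.

Lemma count_divn_leq k j n : 0 < k ->
  count (fun i => i %/ k == j) (iota 0 n) <= k.
Proof.
(* Lengthening the range completes block [j]. *)
move=> k0; rewrite -[X in _ <= X](@count_divn_eq k j (n + j.+1 * k)) ?leq_addl //.
by rewrite iotaD count_cat leq_addr.
Qed.

Lemma card_index_set (V : finType) (A : {set V}) (P : pred nat) :
  #|[set v in A | P (index v (enum A))]| = count P (iota 0 #|A|).
Proof.
rewrite -sum1dep_card -big_enum_cond sum1_count cardE.
have -> : iota 0 (size (enum A)) = [seq index v (enum A) | v <- enum A].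
  apply: (@eq_from_nth _ 0) => [|i]; rewrite size_iota ?size_map // => lti.
  case E: (enum A) (enum_uniq A) lti => [|v s] // us lti.
  by rewrite nth_iota // (nth_map v) // index_uniq.
by rewrite count_map.
Qed.

Lemma card_ord_lt (n m : nat) : m <= n -> #|[set j : 'I_n | j < m]| = m.
Proof.
move=> le_mn; rewrite -sum1dep_card (big_ord_narrow le_mn) /=.
by rewrite sum_nat_const card_ord muln1.
Qed.

Lemma floor_or_ceil (n k m : nat) :
  n %/ k <= m -> m <= ceil_div n k -> m = n %/ k \/ m = ceil_div n k.
Proof.
rewrite /ceil_div; case: (k %| n); rewrite /= ?addn0 ?addn1 => lo hi.
  by left; apply/eqP; rewrite eqn_leq hi lo.
move: hi; rewrite leq_eqVlt ltnS => /orP[/eqP->|hi]; first by right.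
by left; apply/eqP; rewrite eqn_leq hi lo.
Qed.

(** * Rounding the fractional coloring *)

(** Edges are forgotten: components become the fibres of [comp], and injectivity on each fibre will
    imply properness. *)
Lemma proportional_selection (V T C : finType) (k : nat) (comp : V -> T)
    (L : V -> {set C}) :
    0 < k -> (forall t, #|[set v | comp v == t]| <= k) ->
    (forall v, #|L v| = k) ->
  exists f : V -> C, [/\ forall v, f v \in L v,
    forall u v, comp u = comp v -> f u = f v -> u = v
    & forall c, #|[set v | c \in L v]| %/ k <= #|[set v | f v == c]|
                  <= ceil_div #|[set v | c \in L v]| k].
Proof.
move=> k0 comp_le cardL.
pose A c := [set v | c \in L v].
pose blk c v := index v (enum (A c)) %/ k.
pose s (p : T * C) := \sum_v (comp v == p.1) * (v \in A p.2).
have s_le p : s p <= k.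
  apply: leq_trans (comp_le p.1); rewrite -sum1dep_card [leqRHS]big_mkcond /=.
  by apply: leq_sum => v _; case: (_ == _); case: (_ \in _).
(* Rows are the vertices and the nodes p', columns the nodes p and the blocks. Every color gets
   [#|V|] block indices, so that one index type serves all; surplus blocks are empty. *)
pose w (x : V + T * C) (y : T * C + C * 'I_#|V|) : nat := match x, y with
  | inl v, inl p => (comp v == p.1) * (v \in A p.2)
  | inl _, inr _ => 0
  | inr p, inl q => (p == q) * (k - s p)
  | inr p, inr (c, j) => (p.2 == c) *
      \sum_v (comp v == p.1) * ((v \in A c) && (blk c v == j))
  end.
have blk_lt c v : v \in A c -> blk c v < ceil_div #|A c| k.
  move=> vA; rewrite ltnNge leq_ceil_div // -ltnNge.
  by apply: leq_ltn_trans (leq_trunc_div _ _) _; rewrite cardE index_mem mem_enum.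
have ceil_le c : ceil_div #|A c| k <= #|V|.
  by rewrite leq_ceil_div // (leq_trans (max_card _)) // leq_pmulr.
have rowV v : \sum_y w (inl v) y = k.
  rewrite big_sumType /= [X in _ + X]big1_eq addn0 sum_pair /= -[RHS](cardL v).
  under eq_bigr => t _ do rewrite -big_distrr /=.
  rewrite sum_delta -sum1_card [RHS]big_mkcond /=.
  by apply: eq_bigr => c _; rewrite inE.
(* Node p' sends [k - s p] to p and [s p] to blocks, as each vertex counted by [s p] lies in exactly
   one block. *)
have rowP p : \sum_y w (inr p) y = k.
  rewrite big_sumType /= sum_delta sum_pair.
  under [X in _ + X]eq_bigr => c _ do rewrite -big_distrr /=.
  rewrite sum_delta exchange_big /= -[RHS](subnK (s_le p)); congr (_ + _).
  apply: eq_bigr => v _; rewrite -big_distrr /=; congr (_ * _).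
  case: (boolP (v \in A _)) => [vA|_] /=; last by rewrite big1_eq.
  have lt_blk := leq_trans (blk_lt _ _ vA) (ceil_le _).
  rewrite -[RHS](sum_delta (Ordinal lt_blk) (fun=> 1)).
  by apply: eq_bigr => j _; rewrite muln1.
have colP p : \sum_x w x (inl p) = k.
  rewrite big_sumType /=; under [X in _ + X]eq_bigr => q _ do rewrite eq_sym.
  by rewrite sum_delta; exact: subnKC (s_le p).
have colB c (j : 'I_#|V|) : \sum_x w x (inr (c, j)) =
    count (fun i => i %/ k == j) (iota 0 #|A c|).
  rewrite big_sumType /= big1_eq add0n sum_pair /=.
  under eq_bigr => t _ do under eq_bigr => c' _ do rewrite eq_sym.
  under eq_bigr => t _ do rewrite sum_delta.
  rewrite exchange_big /= -card_index_set -sum1dep_card [RHS]big_mkcond /=.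
  by apply: eq_bigr => v _; rewrite sum_delta; case: (_ && _).
have [|||f [fI fw fsat]] := @matching_of_weights_saturating _ _ k w.
- exact: k0.
- by case.
- by case=> [p|[c j]]; rewrite ?colP // colB count_divn_leq.
have /fin_all_exists[g gP] : forall v, exists c,
    c \in L v /\ f (inl v) = inl (comp v, c).
  move=> v; have := fw (inl v); case: (f (inl v)) => [[t c]|] //=.
  by case: eqP => // <-; rewrite inE; case: (boolP (c \in L v)) => // cv _; exists c.
have g_inj u v : comp u = comp v -> g u = g v -> u = v.
  move=> eqc eqg; have [[_ fu] [_ fv]] := (gP u, gP v).
  by have /fI[] : f (inl u) = f (inl v) by rewrite fu fv eqc eqg.
exists g; split; [by move=> v; case: (gP v) | exact: g_inj | move=> c].
rewrite -/(A c); set n := #|A c|.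
have blockI m : m <= #|V| ->
    #|[set inr (T * C) (c, j) | j in [set j : 'I_#|V| | j < m]]| = m.
  by move=> le_m; rewrite card_imset ?card_ord_lt // => i j [].
set S := [set v | g v == c].
have cardS : #|[set f (inr (comp v, c)) | v in S]| = #|S|.
  apply: card_in_imset => u v; rewrite !inE => /eqP gu /eqP gv /fI[eqc].
  by apply: g_inj; rewrite // gu gv.
have le_floor : n %/ k <= ceil_div n k by rewrite leq_addr.
(* Both bounds become inclusions: the partners of the nodes p' over [S] include all complete blocks
   of [c] and are themselves nonempty blocks of [c]. *)
rewrite -cardS -{1}(blockI (n %/ k)) ?(leq_trans le_floor (ceil_le c)) //.
rewrite -(blockI (ceil_div n k)) ?ceil_le //.
apply/andP; split; apply: subset_leq_card; apply/subsetP=> y /imsetP[].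
  move=> j; rewrite inE => ltj ->.
  have [|x fx] := fsat (inr (c, j)).
    by rewrite colB count_divn_eq // -leq_divRL.
  have := fw x; rewrite fx; case: x fx => [//|[t c']] fx /=.
  case: eqP fx => // -> fx _.
  (* The column of p is full too; since p' went to a block, p is taken by a vertex, which lies in
     [t] and has color [c]. *)
  have [x' fx'] := fsat (inl (t, c)) (colP _).
  have := fw x'; rewrite fx'; case: x' fx' => [v|q] fx' /=; last first.
    by case: eqP => // eq_q; move: fx'; rewrite eq_q fx.
  have [_] := gP v; rewrite fx' => -[eq_t gv] _.
  by apply/imsetP; exists v; rewrite ?inE -?gv // -eq_t fx.
move=> v; rewrite inE => /eqP gv ->.
have [_] := gP v; rewrite gv => fv.
(* Here p is taken by [v], so p' goes to a block of [c], which is nonempty because the weight is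
   positive. *)
have := fw (inr (comp v, c)).
case E: (f (inr (comp v, c))) => [q|[c' j]] /=.
  by case: eqP => // eq_q; move: E; rewrite -eq_q -fv => /fI.
case: eqP => // <-; rewrite mul1n => pos.
have [u /andP[uA /eqP uj]] : exists u, (u \in A c) && (blk c u == j).
  apply/existsP; apply: contraTT pos => /existsPn none.
  by rewrite -leqNgt leqn0 big1 // => u _; rewrite (negPf (none u)) muln0.
by apply/imsetP; exists j; rewrite // inE -uj blk_lt.
Qed.

(** * Application to graphs *)

Lemma proportionally_choosable_of_components (G : graph) (k : nat) : 0 < k ->
  (forall A, A \in components G -> #|A| <= k) -> proportionally_choosable G k.
Proof.
move=> k0 compk C L cardL.
pose comp (v : G) := [set u in [set: G] | connect edge v u].
have sub_palette v : {subset L v <= palette L}.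
  by move=> c cv; apply/bigfcupP; exists v; rewrite ?mem_enum.
(* The selection needs a finite type of colors: the palette. *)
pose L' v := fsub (palette L) (L v).
have [|v|f [fL fI fc]] := @proportional_selection G _ _ k comp L' k0.
- move=> t; have [->|/set0Pn[v]] := eqVneq [set v | comp v == t] set0.
    by rewrite cards0.
  rewrite inE => /eqP vt; apply: leq_trans (compk (comp v) _).
    apply: subset_leq_card; apply/subsetP=> u; rewrite inE -vt => /eqP<-.
    by rewrite !inE connect0.
  by apply: imset_f; rewrite inE.
- by rewrite card_fsub ?cardL //; apply/fsubsetP/sub_palette.
exists (fun v => val (f v)); split; first split.
(* Adjacent vertices share a component, so equal colors would force a loop. *)
- move=> u v uv /val_inj eqf; have := edge_irr u.
  have /fI/(_ eqf) eq_uv : comp u = comp v.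
    apply/setP=> x; rewrite !inE /=.
    exact: (same_connect1 (sym_connect_sym (@edge_sym G)) uv).
  by rewrite {2}eq_uv uv.
- by move=> v; have := fL v; rewrite inE.
move=> c cP; have := fc [` cP]%fset.
have -> : #|[set v | [` cP]%fset \in L' v]| = eta L c.
  by apply: eq_card => v; rewrite !inE.
have -> : #|[set v | f v == [` cP]%fset]| = #|[set v | val (f v) == c]|.
  by apply: eq_card => v; rewrite !inE -val_eqE.
by case/andP; apply: floor_or_ceil.
Qed.

Theorem theorem9 (G : graph) (k : nat)
  (hk : \max_(A in components G) #|A| = k) :
  exists m : nat, is_chi_pc G m /\ m <= k.
Proof.
have compk A : A \in components G -> #|A| <= k.
  by move=> AG; rewrite -hk; apply: (leq_bigmax_cond (F := fun A : {set G} => #|A|)).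
have k0 : 0 < k.
  have /card_gt0P[v _] := vertex_gt0 G.
  pose A := [set u in [set: G] | connect edge v u].
  apply: leq_trans (compk A _); last by apply: imset_f; rewrite inE.
  by apply/card_gt0P; exists v; rewrite !inE connect0.
have kP := proportionally_choosable_of_components k0 compk.
(* [asbool] makes choosability a boolean predicate, so that a least good [j] can be taken. *)
pose good j := (0 < j) && boolp.asbool (proportionally_choosable G j).
have good_k : good k by rewrite /good k0; apply/boolp.asboolP.
case: (ex_minnP (ex_intro good k good_k)) => m /andP[m0 /boolp.asboolP mP] minm.
exists m; split; last exact: minm.
by split=> // j j0 jP; apply: minm; rewrite /good j0; apply/boolp.asboolP.
Qed.
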